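(* Let $n\ge1$ and let $X_1,\dots,X_n$ be heavy-tailed real-valued random variables with distributions $F_1,\dots,F_n$, respectively, where $\overline{F_k}(x)=1-F_k(x)>0$ for all $x\in\mathbb{R}$ and all $k$. Assume that for all $1\le i\ne j\le n$, $$\lim_{x\to\infty}\frac{P(X_i>x,\,X_j>x)}{\overline{F_i}(x)+\overline{F_j}(x)}=0.$$ Let $X_{(n)}=\max_{1\le k\le n}X_k$. Then $$\lim_{x\to\infty}\frac{P(X_{(n)}>x)}{\sum_{k=1}^n\overline{F_k}(x)}=1.$$
   Context: A random variable $X$ (or its distribution) is heavy-tailed if $E e^{\alpha X}=\infty$ for all $\alpha>0$. *)

(* Defs.v *)
From HB Require Import structures.
From mathcomp Require Import all_boot all_order all_algebra.
From mathcomp Require Import all_classical all_reals all_analysis.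

Set Implicit Arguments.
Unset Strict Implicit.
Unset Printing Implicit Defensive.

Import Order.TTheory GRing.Theory Num.Theory.
Import numFieldNormedType.Exports.

Local Open Scope classical_set_scope.
Local Open Scope ring_scope.

Definition heavy_tailed (d : measure_display) (T : measurableType d)
    (R : realType) (P : probability T R) (X : {RV P >-> R}) : Prop :=
  forall a : R, 0 < a -> ('E_P[(fun w => expR (a * X w))] = +oo)%E.

(* [fine] only moves probabilities, which are finite, from [\bar R] to [R]. *)
Definition tail (d : measure_display) (T : measurableType d) (R : realType)
    (P : probability T R) (X : {RV P >-> R}) (x : R) : R :=
  1 - fine (cdf X x).

(* In [R] a maximum has no neutral element, so the first variable, which also
   occurs in the family, is used as the initial value. *)
Definition max_rv (d : measure_display) (T : measurableType d) (R : realType)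
    (P : probability T R) (n : nat) (n_gt0 : (0 < n)%N)
    (X : 'I_n -> {RV P >-> R}) (w : T) : R :=
  \big[Num.max/X (Ordinal n_gt0) w]_(k < n) X k w.

(* Main.v *)
(** Put A_k = {X_k > x}.  Removing from each A_k the other A_j leaves disjoint
    sets contained in the union, so
      sum_k P(A_k) - sum_k sum_{j <> k} P(A_k n A_j) <= P(U_k A_k) <= sum_k P(A_k).
    After division by sum_k P(A_k), every term of the double sum is at most
    P(A_k n A_j) / (P(A_k) + P(A_j)), which vanishes by hypothesis. *)

Require Import Defs.
From HB Require Import structures.
From mathcomp Require Import all_boot all_order all_algebra.
From mathcomp Require Import all_classical all_reals all_analysis.

Set Implicit Arguments.
Unset Strict Implicit.
Unset Printing Implicit Defensive.

Import Order.TTheory GRing.Theory Num.Theory.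
Import numFieldNormedType.Exports.

Local Open Scope classical_set_scope.
Local Open Scope ring_scope.

Lemma bigsetUP (I : finType) (T : Type) (Q : pred I) (A : I -> set T) (w : T) :
  (\big[setU/set0]_(i | Q i) A i) w <-> exists2 i, Q i & A i w.
Proof. by have /= <- := @bigcup_pred I T Q A; split=> -[i Qi Aiw]; exists i. Qed.

Section bonferroni.
Local Open Scope ereal_scope.
Context d (T : measurableType d) (R : realType).
Variable mu : {measure set T -> \bar R}.

Lemma measure_bigsetU_le (I : finType) (Q : pred I) (A : I -> set T) :
  (forall i, measurable (A i)) ->
  mu (\big[setU/set0]_(i | Q i) A i) <= \sum_(i | Q i) mu (A i).
Proof.
move=> mA.
(* Measurability of the partial unions is carried through the induction because binary subadditivity
   requires it. *)
suff [] : measurable (\big[setU/set0]_(i | Q i) A i) /\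
    mu (\big[setU/set0]_(i | Q i) A i) <= \sum_(i | Q i) mu (A i) by [].
apply: (big_rec2 (fun U s => measurable U /\ mu U <= s)).
  by rewrite measure0.
move=> i s U _ [mU leUs]; split; first exact: measurableU.
by apply: le_trans (measureU2 _ (mA i) mU) _; exact: leeD2l.
Qed.

(** The correction is added on the right rather than subtracted, since [mu] may take the value
    [+oo]. Summing over ordered pairs counts each intersection twice, which is harmless when every
    pair contributes a vanishing ratio. *)
Lemma bonferroni (n : nat) (A : 'I_n -> set T) :
  (forall i, measurable (A i)) ->
  \sum_(i < n) mu (A i) <= mu (\big[setU/set0]_(i < n) A i)
    + \sum_(i < n) \sum_(j < n | j != i) mu (A i `&` A j).
Proof.
move=> mA.
pose B i := A i `\` \big[setU/set0]_(j < n | j != i) A j.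
have mB i : measurable (B i).
  by apply: measurableD => //; exact: bigsetU_measurable.
have tB : trivIset setT B.
  apply/trivIsetP => i j _ _ ij; apply/seteqP; split => // w [[_ nAj] [Aj _]].
  by apply/nAj/bigsetUP; exists j => //; rewrite eq_sym.
have BU : \big[setU/set0]_(i < n) B i `<=` \big[setU/set0]_(i < n) A i.
  by move=> w /bigsetUP[i _ [Aiw _]]; apply/bigsetUP; exists i.
have leB i : mu (A i) <= mu (B i) + \sum_(j < n | j != i) mu (A i `&` A j).
  have mU : measurable (\big[setU/set0]_(j < n | j != i) A j).
    exact: bigsetU_measurable.
  (* Split [A i] along the union of the other sets; the part inside that union is, by
     distributivity, a union of pairwise intersections. *)
  rewrite (measureDI mu (mA i) mU) leeD2l// big_distrr/=.
  by apply: measure_bigsetU_le => j; exact: measurableI.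
rewrite (le_trans (lee_sum _ (fun i _ => leB i)))// big_split/= leeD2r//.
(* Disjointness turns the sum of the [mu (B i)] into the measure of their union, which [BU] then
   bounds. *)
rewrite -measure_semi_additive_ord//; last exact: bigsetU_measurable.
by apply: le_measure BU; rewrite inE; exact: bigsetU_measurable.
Qed.

End bonferroni.

Lemma set_gtE (T : Type) (R : realType) (f : T -> R) (x : R) :
  [set w | f w > x] = f @^-1` `]x, +oo[.
Proof. by apply/seteqP; split => w /=; rewrite in_itv/= andbT. Qed.

Lemma tailE d (T : measurableType d) (R : realType) (P : probability T R)
    (X : {RV P >-> R}) (x : R) : tail X x = fine (P [set w | X w > x]).
Proof.
rewrite set_gtE.
have := cdf_ccdf_1 X x; rewrite /tail /ccdf /distribution /pushforward/=.
(* [fine] is additive only on finite values, hence the two side goals on the probabilities of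
   complementary events. *)
move/(congr1 fine); rewrite fineD/=.
- move=> <-.
  by rewrite addrC addKr.
- by rewrite fin_num_measure//; exact: measurable_funPTI.
- by rewrite fin_num_measure//; exact: measurable_funPTI.
Qed.

Lemma cvg_sum0 (R : realType) (I : finType) (Q : pred I) (T : Type)
    (F : set_system T) (f : I -> T -> R) : Filter F ->
  (forall i, Q i -> f i x @[x --> F] --> (0 : R)) ->
  \sum_(i | Q i) f i x @[x --> F] --> (0 : R).
Proof.
move=> FF f0; have := @cvg_big R I +%R 0 Q add_continuous T F
  (index_enum I) f (fun=> 0) FF f0.
by rewrite big1_eq; exact.
Qed.

Theorem theorem3p3 (d : measure_display) (T : measurableType d) (R : realType)
    (P : probability T R) (n : nat) (n_gt0 : (0 < n)%N)
    (X : 'I_n -> {RV P >-> R})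
    (X_heavy : forall k : 'I_n, heavy_tailed (X k))
    (tail_gt0 : forall (k : 'I_n) (x : R), 0 < tail (X k) x)
    (joint_tail : forall i j : 'I_n, i != j ->
       fine (P [set w | X i w > x /\ X j w > x])
         / (tail (X i) x + tail (X j) x) @[x --> +oo] --> (0 : R)) :
  fine (P [set w | max_rv n_gt0 X w > x]) / (\sum_(k < n) tail (X k) x)
    @[x --> +oo] --> (1 : R).
Proof.
pose A x k := [set w | X k w > x].
have mA x k : measurable (A x k).
  by rewrite /A set_gtE; exact: measurable_funPTI.
pose U x := \big[setU/set0]_(k < n) A x k.
have mU x : measurable (U x) by exact: bigsetU_measurable.
have max_gtE x : [set w | max_rv n_gt0 X w > x] = U x.
  apply/seteqP; split => w /=.
    (* If the initial value of the maximum exceeds [x], the witness is index 0, since that value is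
       itself a member of the family. *)
    move/bigmax_gtP => [x0|[k _ xk]]; apply/bigsetUP; last by exists k.
    by exists (Ordinal n_gt0).
  by move/bigsetUP => [k _ xk]; apply/bigmax_gtP; right; exists k.
pose S x := \sum_(k < n) tail (X k) x.
have S_gt0 x : 0 < S x.
  rewrite /S (bigD1 (Ordinal n_gt0))//= ltr_pwDl// sumr_ge0// => k _.
  exact: ltW.
have SE x : (S x)%:E = (\sum_(k < n) P (A x k))%E.
  rewrite -sumEFin; apply: eq_bigr => k _.
  by rewrite tailE fineK ?fin_num_measure//; exact: mA.
pose q i j x : R := fine (P [set w | X i w > x /\ X j w > x])
  / (tail (X i) x + tail (X j) x).
have PS x : fine (P (U x)) <= S x.
  by rewrite -lee_fin SE fineK ?fin_num_measure//; exact: measure_bigsetU_le.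
have SP x : S x - \sum_(i < n) \sum_(j < n | j != i) fine (P (A x i `&` A x j))
    <= fine (P (U x)).
  rewrite lerBlDr -lee_fin SE EFinD fineK ?fin_num_measure// -sumEFin.
  apply: (le_trans (bonferroni P (mA x))); rewrite leeD2l//.
  apply: lee_sum => i _; rewrite -sumEFin; apply: lee_sum => j _.
  by rewrite fineK ?fin_num_measure//; exact: measurableI.
apply: (@squeeze_cvgr _ _ _ _
  (fun x => 1 - \sum_(i < n) \sum_(j < n | j != i) q i j x) (fun=> 1)).
- apply: nearW => x; rewrite max_gtE -/(S x); apply/andP; split; last first.
    by rewrite (ler_pdivrMr _ _ (S_gt0 x)) mul1r.
  rewrite (ler_pdivlMr _ _ (S_gt0 x)) (le_trans _ (SP x))// mulrBl mul1r lerB// mulr_suml.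
  apply: ler_sum => i _; rewrite mulr_suml; apply: ler_sum => j ji.
  (* Factoring out the joint probability leaves [1 <= S x / (tail (X i) x + tail (X j) x)]. *)
  rewrite /q -mulrA ler_peMr ?fine_ge0//.
  rewrite mulrC
    (ler_pdivlMr _ _ (addr_gt0 (tail_gt0 i x) (tail_gt0 j x))) mul1r.
  (* As [j != i], the two tails are distinct terms of [S x], and the remaining terms are
     nonnegative. *)
  rewrite /S (bigD1 i)//= (bigD1 j)//= addrA lerDl sumr_ge0// => k _.
  exact: ltW.
- have q_cvg0 : \sum_(i < n) \sum_(j < n | j != i) q i j x
      @[x --> +oo] --> (0 : R).
    apply: cvg_sum0 => i _; apply: cvg_sum0 => j ji; apply: joint_tail.
    by rewrite eq_sym.
  by have := cvgB (cvg_cst (1 : R)) q_cvg0; rewrite subr0; exact.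
- exact: cvg_cst.
Qed.
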